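(* Let $\gamma_k>0$ and $\sigma>0$ with $\gamma_k\sigma>\epsilon$ for some $\epsilon>0$. Let $B_0=\gamma_k^{-1}I$, let $B_1,\dots,B_k$ ($k\ge 1$) be the L-BFGS quasi-Newton matrices generated from $B_0$ by the pairs $(s_0,y_0),\dots,(s_{k-1},y_{k-1})$, with associated vectors $a_i,b_i$, as defined in the context. Let $G=B_0+\sigma I=(\gamma_k^{-1}+\sigma)I$ and $H=\sum_{i=0}^{2k-1}E_i$, where $$E_{2i}=-a_ia_i^T,\qquad E_{2i+1}=b_ib_i^T,\qquad i=0,\dots,k-1.$$ Set $C_0=G$ and $C_{j+1}=G+E_0+\cdots+E_j$ for $j=0,\dots,2k-1$. Then $(B_k+\sigma I)^{-1}=(G+H)^{-1}$ is given by $$(G+H)^{-1}=C_{2k-1}^{-1}-v_{2k-1}\,C_{2k-1}^{-1}E_{2k-1}C_{2k-1}^{-1}$$ together with the recursion $$C_{j+1}^{-1}=C_j^{-1}-v_j\,C_j^{-1}E_jC_j^{-1},\qquad v_j=\frac{1}{1+\operatorname{trace}(C_j^{-1}E_j)},\qquad j=0,\dots,2k-1,$$ where all the inverses $C_j^{-1}$ exist and all the denominators $1+\operatorname{trace}(C_j^{-1}E_j)$ are nonzero.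
   Context: All matrices are real $n\times n$ and all vectors lie in $\mathbb{R}^n$. Given $B_0=\gamma_k^{-1}I$ and vector pairs $(s_i,y_i)$, $i=0,\dots,k-1$, the L-BFGS matrices are defined recursively for $j=1,\dots,k$ by $$B_j=B_0-\sum_{i=0}^{j-1}a_ia_i^T+\sum_{i=0}^{j-1}b_ib_i^T,\qquad a_i=\frac{B_is_i}{\sqrt{s_i^TB_is_i}},\qquad b_i=\frac{y_i}{\sqrt{y_i^Ts_i}}.$$ Standing assumption: the updates are chosen so that these vectors are well defined (in particular $s_i\neq 0$ and $y_i^Ts_i>0$ for all $i$) and all the matrices $B_0,B_1,\dots,B_k$ are positive definite. *)

(* Defs.v *)
From mathcomp Require Import all_boot all_order all_algebra.
From mathcomp Require Import reals.

Set Implicit Arguments.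
Unset Strict Implicit.
Unset Printing Implicit Defensive.

Import Order.TTheory GRing.Theory Num.Theory.
Local Open Scope ring_scope.

Definition posdefmx (R : realType) (n : nat) (A : 'M[R]_n) : Prop :=
  A^T = A /\ forall x : 'cV[R]_n, x != 0 -> 0 < (x^T *m A *m x) 0 0.

(* Vectors are columns; a product u^T *m v is a 1 x 1 matrix, so "0 0" reads it
   off as a scalar. The families are indexed by nat, but only the values
   s i, y i, a i, b i for i < k and B j for j <= k are constrained; those of
   B, a and b are determined by gamma, s and y. *)
Record is_lbfgs (R : realType) (n k : nat) (gamma : R)
    (s y : nat -> 'cV[R]_n) (B : nat -> 'M[R]_n) (a b : nat -> 'cV[R]_n)
    : Prop := IsLbfgs {
  lbfgs_B0 : B 0%N = gamma^-1%:M;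
  lbfgs_B : forall j, (1 <= j <= k)%N ->
    B j = B 0%N - \sum_(i < j) a i *m (a i)^T + \sum_(i < j) b i *m (b i)^T;
  lbfgs_a : forall i, (i < k)%N ->
    a i = (Num.sqrt (((s i)^T *m B i *m s i) 0 0))^-1 *: (B i *m s i);
  lbfgs_b : forall i, (i < k)%N ->
    b i = (Num.sqrt (((y i)^T *m s i) 0 0))^-1 *: y i;
  lbfgs_s_neq0 : forall i, (i < k)%N -> s i != 0;
  lbfgs_ys_gt0 : forall i, (i < k)%N -> 0 < ((y i)^T *m s i) 0 0;
  lbfgs_posdef : forall j, (j <= k)%N -> posdefmx (B j)
}.

(* E_(2i) = - a_i a_i^T and E_(2i+1) = b_i b_i^T *)
Definition lbfgs_E (R : realType) (n : nat) (a b : nat -> 'cV[R]_n)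
    (m : nat) : 'M[R]_n :=
  if odd m then b m./2 *m (b m./2)^T else - (a m./2 *m (a m./2)^T).

(* Main.v *)
Require Import Defs.
From mathcomp Require Import all_boot all_order all_algebra.
From mathcomp Require Import reals.
From mathcomp Require Import ring.

Set Implicit Arguments.
Unset Strict Implicit.
Unset Printing Implicit Defensive.

Import Order.TTheory GRing.Theory Num.Theory.
Local Open Scope ring_scope.

(** The matrices C_j are the shifted BFGS matrices together with the
    intermediate ones met halfway through each BFGS update:
    C_(2i) = B_i + sigma I and C_(2i+1) = B_i - a_i a_i^T + sigma I.

    All of them have a positive quadratic form, hence are invertible
    ([unitmx_of_form_gt0]).  For the even ones this is the positive definiteness
    of B_i.  For the odd ones, x^T a_i is the B_i-inner product of x with the
    B_i-normalised s_i, so x^T (B_i - a_i a_i^T) x >= 0 is the Cauchy-Schwarz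
    inequality for B_i ([sqr_form_le]); this form does vanish at s_i, and it is
    the shift sigma I that makes C_(2i+1) definite.

    Each E_j has the shape p q with p a column and q a row, so C_(j+1) is a
    rank-one perturbation of C_j and the recursion is the Sherman-Morrison
    formula.  Here both C_j and C_(j+1) are already known to be invertible, and
    that alone forces 1 + trace(C_j^-1 E_j) to be nonzero
    ([rank1_update_trace_neq0]). *)

Lemma unitmx_of_form_gt0 (R : realFieldType) (n : nat) (A : 'M[R]_n) :
  (forall x : 'cV[R]_n, x != 0 -> 0 < (x^T *m A *m x) 0 0) -> A \in unitmx.
Proof.
move=> Apos; rewrite -row_free_unit -kermx_eq0.
apply/negPn/negP => /rowV0Pn[u /sub_kermxP uA0 u_neq0].
have := Apos u^T; rewrite trmx_eq0 => /(_ u_neq0).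
by rewrite trmxK uA0 mul0mx mxE ltxx.
Qed.

Lemma form_scalar_gt0 (R : realFieldType) (n : nat) (c : R) (x : 'cV[R]_n) :
  0 < c -> x != 0 -> 0 < (x^T *m c%:M *m x) 0 0.
Proof.
move=> c_gt0 x_neq0; rewrite mul_mx_scalar -scalemxAl mxE mulr_gt0 //.
have [i xi_neq0] : exists i, x i 0 != 0 by apply/cV0Pn.
rewrite mxE (bigD1 i) //= mxE ltr_pwDl ?sumr_ge0 //.
  by rewrite -expr2 exprn_even_gt0.
by move=> j _; rewrite mxE -expr2 sqr_ge0.
Qed.

(** Cauchy-Schwarz for the inner product of A, from the positivity of the form
    at the A-orthogonal projection of x off the line of s. *)
Lemma sqr_form_le (R : realType) (n : nat) (A : 'M[R]_n) (s x : 'cV[R]_n) :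
  posdefmx A -> s != 0 ->
  ((x^T *m A *m s) 0 0) ^+ 2 / (s^T *m A *m s) 0 0 <= (x^T *m A *m x) 0 0.
Proof.
move=> [Asym Apos] s_neq0.
have d_gt0 := Apos s s_neq0.
have Age0 (z : 'cV[R]_n) : 0 <= (z^T *m A *m z) 0 0.
  have [->|/Apos/ltW//] := eqVneq z 0.
  by rewrite mulmx0 mxE.
have sx_xs : (s^T *m A *m x) 0 0 = (x^T *m A *m s) 0 0.
  have -> : s^T *m A *m x = (x^T *m A *m s)^T.
    by rewrite !trmx_mul trmxK Asym mulmxA.
  by rewrite mxE.
set d : R := (s^T *m A *m s) 0 0 in d_gt0 *.
set c : R := (x^T *m A *m s) 0 0 in sx_xs *.
(* plain mxE would also expand the products into sums *)
have entryB (P Q : 'M[R]_1) : (P - Q) 0 0 = P 0 0 - Q 0 0 by rewrite !mxE.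
have entryZ t (P : 'M[R]_1) : (t *: P) 0 0 = t * P 0 0 by rewrite mxE.
have := Age0 (x - (c / d) *: s).
have -> : ((x - (c / d) *: s)^T *m A *m (x - (c / d) *: s)) 0 0
        = (x^T *m A *m x) 0 0 - c ^+ 2 / d.
  rewrite [_^T]linearB /= [(_ *: _)^T]linearZ /= !mulmxBl !mulmxBr -!scalemxAl -!scalemxAr.
  rewrite !(entryB, entryZ) -/c -/d sx_xs.
  by field; rewrite gt_eqF.
by rewrite subr_ge0.
Qed.

(** With p and q rank-one factors, (A + p q) A^-1 p = (1 + q A^-1 p) p: this
    identity yields both parts of the Sherman-Morrison formula below. *)
Lemma invmx_rank1_update_col (F : fieldType) (n : nat) (A : 'M[F]_n)
    (p : 'cV[F]_n) (q : 'rV[F]_n) :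
  A \in unitmx -> A + p *m q \in unitmx ->
  invmx A *m p = (1 + \tr (invmx A *m (p *m q))) *: (invmx (A + p *m q) *m p).
Proof.
move=> Au Apqu.
rewrite mulmxA mxtrace_mulC trace_mx11.
set t := (q *m (invmx A *m p)) 0 0.
rewrite scalemxAr; apply: (canRL (mulKmx Apqu)).
rewrite mulmxDl mulKVmx // -mulmxA [q *m _]mx11_scalar -/t mul_mx_scalar.
by rewrite scalerDl scale1r.
Qed.

(** If 1 + q A^-1 p vanished, A^-1 p would lie in the kernel of A + p q, so p
    would be zero, and then the trace is 0 and not -1. *)
Lemma rank1_update_trace_neq0 (F : fieldType) (n : nat) (A : 'M[F]_n)
    (p : 'cV[F]_n) (q : 'rV[F]_n) :
  A \in unitmx -> A + p *m q \in unitmx ->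
  1 + \tr (invmx A *m (p *m q)) != 0.
Proof.
move=> Au Apqu; apply/eqP => t0.
have := invmx_rank1_update_col Au Apqu; rewrite t0 scale0r => Ap0.
move: t0; rewrite mulmxA Ap0 mul0mx mxtrace0 addr0.
by apply/eqP; rewrite oner_eq0.
Qed.

Lemma invmx_rank1_update (F : fieldType) (n : nat) (A : 'M[F]_n)
    (p : 'cV[F]_n) (q : 'rV[F]_n) :
  A \in unitmx -> A + p *m q \in unitmx ->
  invmx (A + p *m q)
    = invmx A - (1 / (1 + \tr (invmx A *m (p *m q))))
                *: (invmx A *m (p *m q) *m invmx A).
Proof.
move=> Au Apqu.
have t_neq0 := rank1_update_trace_neq0 Au Apqu.
have -> : invmx A *m (p *m q) *m invmx A = invmx A *m p *m (q *m invmx A).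
  by rewrite !mulmxA.
rewrite (invmx_rank1_update_col Au Apqu).
rewrite -!scalemxAl scalerA div1r mulVf // scale1r.
(* it remains to see that A'^-1 (A + p q) A^-1 = A^-1 for A' = A + p q *)
apply/eqP; rewrite eq_sym subr_eq; apply/eqP.
rewrite -[LHS](mulKmx Apqu) mulmxDl mulmxV // mulmxDr mulmx1.
by rewrite !mulmxA.
Qed.

Section LbfgsPartialSums.

Variables (R : realType) (n k : nat) (gamma sigma : R).
Variables (s y : nat -> 'cV[R]_n) (B : nat -> 'M[R]_n) (a b : nat -> 'cV[R]_n).
Hypothesis sigma_gt0 : 0 < sigma.
Hypothesis hB : is_lbfgs k gamma s y B a b.

Let C j := B 0%N + sigma%:M + \sum_(i < j) lbfgs_E a b i.

Lemma lbfgs_E_even i : lbfgs_E a b (2 * i) = - (a i *m (a i)^T).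
Proof. by rewrite /lbfgs_E mul2n odd_double doubleK. Qed.

Lemma lbfgs_E_odd i : lbfgs_E a b (2 * i).+1 = b i *m (b i)^T.
Proof. by rewrite /lbfgs_E mul2n /= odd_double /= uphalf_double. Qed.

Lemma lbfgs_E_rank1 j : exists (p : 'cV[R]_n) (q : 'rV[R]_n), lbfgs_E a b j = p *m q.
Proof.
rewrite /lbfgs_E; case: ifP => _; first by exists (b j./2), (b j./2)^T.
by exists (- a j./2), (a j./2)^T; rewrite mulNmx.
Qed.

Lemma sum_lbfgs_E_double i :
  \sum_(m < 2 * i) lbfgs_E a b m
  = \sum_(m < i) b m *m (b m)^T - \sum_(m < i) a m *m (a m)^T.
Proof.
elim: i => [|i IHi]; first by rewrite muln0 !big_ord0 subr0.
rewrite mulnS add2n !big_ord_recr /= IHi lbfgs_E_even lbfgs_E_odd.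
by rewrite opprD [RHS]addrACA -addrA [- _ + _]addrC.
Qed.

Lemma lbfgs_partial_sum_even i : (i <= k)%N -> C (2 * i) = B i + sigma%:M.
Proof.
case: i => [|i] i_le_k; first by rewrite /C muln0 big_ord0 addr0.
rewrite /C sum_lbfgs_E_double (lbfgs_B hB (i_le_k : 1 <= i.+1 <= k)%N).
by rewrite addrAC; congr (_ + _); rewrite [X in _ + X]addrC addrA.
Qed.

Lemma lbfgs_partial_sum_odd i : (i < k)%N ->
  C (2 * i).+1 = B i - a i *m (a i)^T + sigma%:M.
Proof.
move=> i_lt_k; rewrite addrAC -(lbfgs_partial_sum_even (ltnW i_lt_k)).
by rewrite /C big_ord_recr /= lbfgs_E_even addrA.
Qed.

(** The square of x^T a_i is the left-hand side of Cauchy-Schwarz for B_i, by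
    the normalisation of a_i. *)
Lemma lbfgs_form_downdate_ge0 i (x : 'cV[R]_n) : (i < k)%N ->
  0 <= (x^T *m (B i - a i *m (a i)^T) *m x) 0 0.
Proof.
move=> i_lt_k; have Bpos := lbfgs_posdef hB (ltnW i_lt_k).
have s_neq0 := lbfgs_s_neq0 hB i_lt_k.
have := sqr_form_le x Bpos s_neq0.
have d_gt0 := Bpos.2 _ s_neq0.
suff -> : (x^T *m (B i - a i *m (a i)^T) *m x) 0 0
    = (x^T *m B i *m x) 0 0
      - ((x^T *m B i *m s i) 0 0) ^+ 2 / ((s i)^T *m B i *m s i) 0 0.
  by rewrite subr_ge0.
rewrite mulmxBr mulmxBl [LHS]mxE; congr (_ + _); rewrite mxE; congr (- _).
have -> : x^T *m (a i *m (a i)^T) *m x = (x^T *m a i) *m (x^T *m a i)^T.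
  by rewrite trmx_mul trmxK !mulmxA.
rewrite mxE big_ord1 [_^T 0 0]mxE (lbfgs_a hB i_lt_k) -scalemxAr mxE mulmxA.
by rewrite -expr2 exprMn exprVn sqr_sqrtr ?ltW // mulrC.
Qed.

Lemma lbfgs_partial_sum_unit j : (j <= 2 * k)%N -> C j \in unitmx.
Proof.
move=> j_le; apply: unitmx_of_form_gt0 => x x_neq0.
have sx_gt0 := form_scalar_gt0 sigma_gt0 x_neq0.
have := odd_double_half j; rewrite -mul2n; case: (odd j) => /= jE.
- have h_lt_k : (j./2 < k)%N by rewrite -(ltn_pmul2l (isT : 0 < 2)%N) -add1n jE.
  rewrite -jE add1n lbfgs_partial_sum_odd // mulmxDr mulmxDl mxE.
  by rewrite ltr_wpDl // lbfgs_form_downdate_ge0.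
- have h_le_k : (j./2 <= k)%N.
    by rewrite -(leq_pmul2l (isT : 0 < 2)%N) -[X in (X <= _)%N]add0n jE.
  rewrite -jE add0n lbfgs_partial_sum_even // mulmxDr mulmxDl mxE.
  by rewrite addr_gt0 //; case: (lbfgs_posdef hB h_le_k) => _; exact.
Qed.

End LbfgsPartialSums.

Theorem theorem3 (R : realType) (n k : nat) (gamma sigma eps : R)
    (s y : nat -> 'cV[R]_n) (B : nat -> 'M[R]_n) (a b : nat -> 'cV[R]_n)
    (hk : (1 <= k)%N) (hgamma : 0 < gamma) (hsigma : 0 < sigma)
    (heps : 0 < eps) (hge : eps < gamma * sigma)
    (hB : is_lbfgs k gamma s y B a b) :
  let G : 'M[R]_n := B 0%N + sigma%:M in
  let E : nat -> 'M[R]_n := lbfgs_E a b in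
  let H : 'M[R]_n := \sum_(i < 2 * k) E i in
  let C : nat -> 'M[R]_n := fun j => G + \sum_(i < j) E i in
  let v : nat -> R := fun j => 1 / (1 + \tr (invmx (C j) *m E j)) in
  [/\ G = (gamma^-1 + sigma)%:M,
      B k + sigma%:M \in unitmx /\ G + H \in unitmx,
      (forall j, (j <= 2 * k)%N -> C j \in unitmx) /\
        (forall j, (j < 2 * k)%N -> 1 + \tr (invmx (C j) *m E j) != 0),
      invmx (B k + sigma%:M) = invmx (G + H) /\
        invmx (G + H) = invmx (C (2 * k - 1)%N)
          - v (2 * k - 1)%N *: (invmx (C (2 * k - 1)%N)
              *m E (2 * k - 1)%N *m invmx (C (2 * k - 1)%N))
    & forall j, (j < 2 * k)%N ->
        invmx (C j.+1) = invmx (C j)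
          - v j *: (invmx (C j) *m E j *m invmx (C j))].
Proof.
move=> G E H C v.
have C_unit j : (j <= 2 * k)%N -> C j \in unitmx.
  by move=> j_le; apply: (lbfgs_partial_sum_unit hsigma hB).
have CS j : C j.+1 = C j + E j by rewrite /C big_ord_recr /= addrA.
have step j : (j < 2 * k)%N ->
    1 + \tr (invmx (C j) *m E j) != 0 /\
    invmx (C j.+1) = invmx (C j) - v j *: (invmx (C j) *m E j *m invmx (C j)).
  move=> j_lt; have Cj := C_unit _ (ltnW j_lt); have := C_unit _ j_lt.
  have [p [q Epq]] := lbfgs_E_rank1 a b j.
  rewrite /v CS /E Epq => Cj1.
  by split; [apply: rank1_update_trace_neq0|apply: invmx_rank1_update].
have Bk : B k + sigma%:M = G + H.
  by rewrite -(lbfgs_partial_sum_even sigma hB (leqnn k)).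
have GH_unit : G + H \in unitmx by exact: (C_unit _ (leqnn _)).
have k2_gt0 : (0 < 2 * k)%N by rewrite muln_gt0.
split.
- by rewrite /G (lbfgs_B0 hB) -raddfD.
- by rewrite Bk.
- by split=> // j /step[].
- rewrite Bk; split=> //.
  have k2E : (2 * k - 1).+1 = (2 * k)%N by rewrite subn1 prednK.
  have -> : G + H = C (2 * k - 1).+1 by rewrite k2E.
  by apply: (step _ _).2; rewrite k2E.
- by move=> j /step[].
Qed.
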